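(* Let $G$ be an ample Hausdorff groupoid with source map $s$ and unit space $G^{(0)}$, let $K$ be a field, and let $c:G\to H$ be a continuous cocycle into a discrete group $H$, with image $\operatorname{im}(c)=c(G)$. Assume that $s(c^{-1}(h))=G^{(0)}$ for every $h\in\operatorname{im}(c)$. If $A_K(G)_h$ is infinite-dimensional for some $h\in\operatorname{im}(c)$, then $A_K(G)_g$ is infinite-dimensional for every $g\in\operatorname{im}(c)$.
   Context: An ample Hausdorff groupoid is a locally compact Hausdorff étale topological groupoid $G$ having a basis of compact open bisections, where a bisection is a set $U\subseteq G$ such that the range map $r$ and the source map $s$ restrict to bijections from $U$ onto $r(U)$ and $s(U)$. A cocycle is a groupoid homomorphism $c:G\to H$. The Steinberg algebra is $A_K(G)=\mathrm{span}_K\{1_U: U\subseteq G\text{ a compact open bisection}\}$ with convolution product, determined by $1_U*1_V=1_{UV}$. The cocycle $c$ induces the $H$-grading $A_K(G)=\bigoplus_{h\in H}A_K(G)_h$, where $A_K(G)_h=\mathrm{span}_K\{1_U: U\subseteq c^{-1}(h)\text{ a compact open bisection}\}$. Dimensions are over $K$. *)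

(* Defs.v *)
From HB Require Import structures.
From mathcomp Require Import all_boot all_algebra.
From mathcomp Require Import all_classical topology numfun.

Set Implicit Arguments.
Unset Strict Implicit.
Unset Printing Implicit Defensive.

Import GRing.Theory.
Local Open Scope classical_set_scope.
Local Open Scope ring_scope.

(* A groupoid is given by its arrows; units are arrows, as usual.  [gmul] is a
   total function, but it is only constrained on composable pairs, i.e. pairs
   (x, y) with [gsrc x = grng y]; its other values are junk. *)
HB.mixin Record isGroupoid (G : Type) := {
  gsrc : G -> G;
  grng : G -> G;
  gmul : G -> G -> G;
  ginv : G -> G;
  gsrc_src : forall x, gsrc (gsrc x) = gsrc x;
  grng_src : forall x, grng (gsrc x) = gsrc x;
  gsrc_rng : forall x, gsrc (grng x) = grng x;
  grng_rng : forall x, grng (grng x) = grng x;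
  gsrc_mul : forall x y, gsrc x = grng y -> gsrc (gmul x y) = gsrc y;
  grng_mul : forall x y, gsrc x = grng y -> grng (gmul x y) = grng x;
  gmulA : forall x y z, gsrc x = grng y -> gsrc y = grng z ->
    gmul x (gmul y z) = gmul (gmul x y) z;
  grng_gmul : forall x, gmul (grng x) x = x;
  gmul_gsrc : forall x, gmul x (gsrc x) = x;
  gsrc_inv : forall x, gsrc (ginv x) = grng x;
  grng_inv : forall x, grng (ginv x) = gsrc x;
  gmulV : forall x, gmul x (ginv x) = grng x;
  gmulVl : forall x, gmul (ginv x) x = gsrc x
}.

#[short(type="groupoidType")]
HB.structure Definition Groupoid := {G of isGroupoid G}.

Definition units (G : groupoidType) : set G := range (@gsrc G).
Arguments units : clear implicits.

Definition composable (G : groupoidType) : set (G * G) :=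
  [set p | gsrc p.1 = grng p.2].
Arguments composable : clear implicits.

(* Continuity of the source and range maps follows from these axioms. *)
HB.mixin Record Groupoid_isTopological G of Groupoid G & Topological G := {
  gmul_continuous :
    {within composable G, continuous (fun p : G * G => gmul p.1 p.2)};
  ginv_continuous : continuous (@ginv G)
}.

#[short(type="topologicalGroupoidType")]
HB.structure Definition TopologicalGroupoid :=
  {G of Groupoid G & Topological G & Groupoid_isTopological G}.

Definition local_homeomorphism (X Y : topologicalType) (f : X -> Y) :=
  forall x, exists U : set X,
    [/\ open U, U x, open (f @` U), {within U, continuous f} &
      exists2 g : Y -> X, {within f @` U, continuous g} & {in U, cancel f g}].

(* On subsets of [units G], being open in [subspace (units G)] is being open in
   the relative topology of the unit space. *)
Definition etale (G : topologicalGroupoidType) :=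
  local_homeomorphism (@gsrc G : G -> subspace (units G)).

Definition bisection (G : groupoidType) (U : set G) :=
  set_inj U (@grng G) /\ set_inj U (@gsrc G).

Definition compact_open_bisection (G : topologicalGroupoidType) (U : set G) :=
  [/\ compact U, open U & bisection U].

Definition ample_hausdorff (G : topologicalGroupoidType) :=
  [/\ hausdorff_space G, locally_compact [set: G], etale G &
    exists2 B : set (set G), basis B & B `<=` @compact_open_bisection G].
Arguments etale : clear implicits.
Arguments ample_hausdorff : clear implicits.

Definition cocycle (G : groupoidType) (H : groupType) (c : G -> H) :=
  forall x y : G, gsrc x = grng y -> c (gmul x y) = (c x * c y)%g.

Section LinearSpan.
Variables (K : fieldType) (V : lmodType K).

Definition linear_span (A : set V) : set V :=
  [set v | exists n (a : 'I_n -> K) (e : 'I_n -> V),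
    (forall i, A (e i)) /\ v = \sum_i a i *: e i].

Definition finite_dimensional (W : set V) :=
  exists2 B : set V, finite_set B & W = linear_span B.

Definition infinite_dimensional (W : set V) := ~ finite_dimensional W.

End LinearSpan.

(* [K^o] is K seen as a vector space over itself. *)
Definition steinberg_component (K : fieldType) (G : topologicalGroupoidType)
    (H : groupType) (c : G -> H) (h : H) : set (G -> K^o) :=
  linear_span [set (\1_U : G -> K^o) | U in
    [set U : set G | compact_open_bisection U /\ U `<=` c @^-1` [set h]]].
Arguments steinberg_component K {G H} c h.

(* Main.v *)
Require Import Defs.
From HB Require Import structures.
From mathcomp Require Import all_boot finmap all_algebra.
From mathcomp Require Import all_classical topology numfun.

Local Open Scope classical_set_scope.

(** The dimension of [A_K(G)_h] is infinite exactly when the fibre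
    [c^-1(h)] is an infinite set, so the theorem is a statement about
    cardinalities of fibres.

    If [c^-1(h)] is finite, it has finitely many subsets, hence
    [A_K(G)_h] is spanned by finitely many indicator functions
    ([steinberg_component_finite_dimensional]).  Conversely, [c^-1(h)] is open
    in a Hausdorff space with a basis of compact open bisections, so any [n] of
    its points are separated by [n] such bisections contained in it; their
    indicators are linearly independent, as evaluation at the points
    shows.  So a finite dimension bounds the number of points
    ([finite_dimensional_fibre_finite]).

    It remains to see that if one fibre [c^-1(g)] with [s(c^-1(g)) = G^(0)] is
    finite, then every fibre [c^-1(h)] is ([cocycle_fibre_finite]).  The unit
    space, being the image of [c^-1(g)], is finite, so [c^-1(h)] splits into
    finitely many pieces according to the range of its elements.  If [x0] is
    in the piece of range [v], pick [y] in [c^-1(g)] with [s(y) = s(x0)].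
    Left translation by [y x0^-1] is injective and maps this piece into
    [c^-1(g)], so the piece is finite. *)

Lemma finite_subsets (T : eqType) (A : set T) :
  finite_set A -> finite_set [set U : set T | U `<=` A].
Proof.
move=> /finite_seqP[s ->].
(* Every subset of [s] is selected by a boolean mask. *)
pose F (m : (size s).-tuple bool) : set T := [set` mask m s].
apply: (@sub_finite_set _ _ (F @` setT)).
  move=> U /= Us; exists [tuple of map (fun x => x \in U) (in_tuple s)] => //.
  rewrite /F /= -filter_mask; apply/seteqP; split => x /=.
    by rewrite mem_filter => /andP[/set_mem].
  by move=> Ux; rewrite mem_filter mem_set //=; exact: Us.
exact/finite_image/finite_finset.
Qed.

Section Span.
Local Open Scope ring_scope.
Import GRing.Theory.

Lemma linear_span_seq {K : fieldType} {V : lmodType K} {s : seq V} {v : V} :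
  linear_span [set` s] v ->
  exists a : 'I_(size s) -> K, v = \sum_k a k *: s`_k.
Proof.
move=> [n [a [e [es ->]]]].
have ltk i : (index (e i) s < size s)%N by rewrite index_mem; exact: es.
pose p i := Ordinal (ltk i).
(* Collect the coefficients of all summands equal to the same generator. *)
exists (fun k => \sum_(i | p i == k) a i).
rewrite (partition_big p predT) //=; apply: eq_bigr => k _.
rewrite scaler_suml; apply: eq_bigr => i /eqP <-.
by rewrite nth_index //; exact: es.
Qed.

(** Functions that are dual to points are linearly independent: their matrix
    of values is the identity, which factors through the span, so its rank is
    at most the number of generators. *)
Lemma dual_functions_bound {K : fieldType} {T : Type} {B : set (T -> K^o)} :
  finite_set B -> exists N, forall n (x : 'I_n -> T) (f : 'I_n -> T -> K^o),
    (forall i, linear_span B (f i)) ->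
    (forall i j, f i (x j) = (i == j)%:R) -> (n <= N)%N.
Proof.
move=> /finite_seqP[s ->]; exists (size s) => n x f fs fx.
have /choice[a fE] : forall i, exists a : 'I_(size s) -> K,
    f i = \sum_k a k *: s`_k by move=> i; exact/linear_span_seq/fs.
rewrite -(mxrank1 K n).
have -> : 1%:M = (\matrix_(i, k) a i k) *m
                 (\matrix_(k, j) (s`_k : T -> K^o) (x j)).
  apply/matrixP => i j; rewrite !mxE -fx fE fct_sumE.
  by apply: eq_bigr => k _; rewrite !mxE.
exact: mulmx_max_rank.
Qed.

End Span.

Section Cocycle.
Variables (G : groupoidType) (H : groupType) (c : G -> H).
Hypothesis c_cocycle : cocycle c.
Local Open Scope group_scope.

Lemma cocycle_gsrc x : c (gsrc x) = 1.
Proof.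
apply: (mulgI (c x)); rewrite mulg1 -c_cocycle ?gmul_gsrc //.
by rewrite grng_src.
Qed.

Lemma cocycle_ginv x : c (ginv x) = (c x)^-1.
Proof.
apply: (mulIg (c x)); rewrite mulVg -c_cocycle ?gsrc_inv //.
by rewrite gmulVl cocycle_gsrc.
Qed.

Lemma gmulK (w x : G) : gsrc w = grng x -> gmul (ginv w) (gmul w x) = x.
Proof. by move=> wx; rewrite gmulA ?gsrc_inv // gmulVl wx grng_gmul. Qed.

(** The elements of [c^-1(h)] with a common range [v] are carried into
    [c^-1(g)] by one left translation, because some element of [c^-1(g)] has
    the source needed to multiply it by the inverse of one of them.  There are
    only finitely many [v] because the units are the sources of the finite
    set [c^-1(g)]. *)
Lemma cocycle_fibre_finite (g h : H) :
  units G `<=` (@gsrc G) @` (c @^-1` [set g]) ->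
  finite_set (c @^-1` [set g]) -> finite_set (c @^-1` [set h]).
Proof.
move=> units_g fin_g.
have fin_units : finite_set (units G).
  exact: sub_finite_set units_g (finite_image _ fin_g).
pose piece v := [set x | c x = h /\ grng x = v].
apply: (@sub_finite_set _ _ (\bigcup_(v in units G) piece v)).
  move=> x /= cx; exists (grng x) => //.
  by exists (grng x); rewrite ?gsrc_rng.
apply: bigcup_finite => // v _.
have [->|[x0 [cx0 rx0]]] : piece v = set0 \/ piece v !=set0.
  by have [->|/set0P] := eqVneq (piece v) set0; [left|right].
  exact: finite_set0.
have [y /= cy sy] : ((@gsrc G) @` (c @^-1` [set g])) (gsrc x0).
  by apply: units_g; exists x0.
(* [c w = g h^-1], so left translation by [w] turns the value [h] into [g]. *)
pose w := gmul y (ginv x0).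
have y_x0V : gsrc y = grng (ginv x0) by rewrite grng_inv.
have sw : gsrc w = v by rewrite gsrc_mul // gsrc_inv.
apply: (@sub_finite_set _ _ (gmul (ginv w) @` (c @^-1` [set g]))).
  move=> x [cx rx]; exists (gmul w x); last by rewrite gmulK // sw rx.
  rewrite /= c_cocycle ?sw ?rx // c_cocycle // cocycle_ginv cy cx0 cx.
  by rewrite mulgVK.
exact: finite_image.
Qed.

End Cocycle.

Lemma steinberg_component_finite_dimensional (K : fieldType)
    (G : topologicalGroupoidType) (H : groupType) (c : G -> H) (h : H) :
  finite_set (c @^-1` [set h]) ->
  finite_dimensional (steinberg_component K c h).
Proof.
move=> fin_h; eexists; last by reflexivity.
apply: finite_image; apply: sub_finite_set (finite_subsets _ _ fin_h).
by move=> U [].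
Qed.

Lemma basis_separates (T : topologicalType) (B : set (set T)) (W F : set T)
    (x : T) :
  accessible_space T -> basis B -> open W -> W x -> finite_set F ->
  exists2 U, B U & [/\ U x, U `<=` W & forall y, F y -> y <> x -> ~ U y].
Proof.
move=> T1 [_ Bx] oW Wx finF.
have oV : open (W `&` ~` (F `\ x)).
  apply: openI => //; apply: closed_openC.
  by move/accessible_finite_set_closed: T1; apply; exact: finite_setD.
have Vx : (W `&` ~` (F `\ x)) x by split=> // -[_ /(_ erefl)].
have [U [BU Ux] UV] := Bx x _ (open_nbhs_nbhs (conj oV Vx)).
exists U => //; split=> //; first by move=> y /UV[].
by move=> y Fy yx /UV[_]; apply.
Qed.

(** Bisections in [c^-1(g)] isolating each of finitely many of its points from
    the others give indicator functions dual to these points; they need not be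
    disjoint. *)
Lemma finite_dimensional_fibre_finite (K : fieldType)
    (G : topologicalGroupoidType) (H : groupType) (c : G -> H) (g : H) :
  ample_hausdorff G -> continuous (c : G -> discrete_topology H) ->
  finite_dimensional (steinberg_component K c g) ->
  finite_set (c @^-1` [set g]).
Proof.
move=> [G_T2 _ _ [B B_basis B_cob]] c_cont [E finE spanE].
have open_g : open (c @^-1` [set g]).
  move/continuousP: c_cont; apply; exact: discrete_open.
have [N boundN] := dual_functions_bound finE.
apply: contrapT => /(infinite_set_fset N.+1)[D Dg ltND].
pose x (i : 'I_#|` D|) := tnth (in_tuple D) i.
have xD i : [set` D] (x i) by exact: mem_tnth.
have x_inj : injective x by apply/tuple_uniqP; exact: fset_uniq.
have /choice[U Ux] : forall i, exists U : set G,
    B U /\ [/\ U (x i), U `<=` c @^-1` [set g] &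
      forall y, [set` D] y -> y <> x i -> ~ U y].
  move=> i; have [||U] := @basis_separates G B _ [set` D] (x i)
    (hausdorff_accessible G_T2) B_basis open_g; first exact: Dg.
    exact: finite_fset.
  by exists U.
suff : (#|` D| <= N)%N by rewrite leqNgt ltND.
apply: (boundN _ x (fun i => \1_(U i) : G -> K^o)%R) => [i|i j].
  rewrite -spanE; have [BU [_ Ug _]] := Ux i.
  exists 1%N, (fun=> 1%R), (fun=> \1_(U i) : G -> K^o)%R; split; last first.
    by rewrite big_ord1 GRing.scale1r.
  by move=> _; exists (U i) => //; split=> //; exact: B_cob.
have [_ [Uxi _ Un]] := Ux i.
rewrite indicE; have [<-|ij] := eqVneq i j; first by rewrite mem_set.
rewrite memNset //; apply: Un; first exact: xD.
by move/x_inj => ji; rewrite ji eqxx in ij.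
Qed.

Theorem proposition3p5 (K : fieldType) (G : topologicalGroupoidType)
    (H : groupType) (c : G -> H)
    (G_ample : ample_hausdorff G)
    (c_cocycle : cocycle c)
    (c_continuous : continuous (c : G -> discrete_topology H))
    (c_source : forall h : H, range c h ->
      (@gsrc G) @` (c @^-1` [set h]) = units G)
    (c_infinite : exists2 h : H, range c h &
      infinite_dimensional (steinberg_component K c h)) :
  forall g : H, range c g -> infinite_dimensional (steinberg_component K c g).
Proof.
move=> g cg fin_g; have [h _] := c_infinite; apply.
apply: steinberg_component_finite_dimensional.
apply: (cocycle_fibre_finite _ _ _ c_cocycle g); first by rewrite c_source.
exact: finite_dimensional_fibre_finite G_ample c_continuous fin_g.
Qed.
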